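(* Let $(X,\|\cdot\|)$ be a smooth normed space and, for $x\in X_o$ and $y\in X$, let $$g(x,y)=\|x\|\lim_{t\to 0}\frac{\|x+ty\|-\|x\|}{t}.$$ Then for all $x,y\in X_o$, $$\mathrm{cm}(x,y)=\frac{g(x,y)}{\|x\|\,\|y\|}.$$
   Context: A normed (Minkowski) space is a finite dimensional real vector space $X$ endowed with a norm $\|\cdot\|$; $X_o=X\setminus\{o\}$, where $o$ is the origin. The space is smooth if the unit ball has exactly one supporting hyperplane at each point of the unit sphere. For $x\in X_o$ let $f_x\in X^*$ be the (up to multiplication by a positive scalar unique) nonzero linear functional attaining its norm at $x/\|x\|$, i.e. $f_x(x)=\|f_x\|_*\|x\|$, where $\|\cdot\|_*$ is the dual norm. The cosine function of a smooth normed space is $\mathrm{cm}(x,y)=\dfrac{f_x(y)}{\|f_x\|_*\,\|y\|}$ for $x,y\in X_o$. *)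

(* Defs.v *)
From HB Require Import structures.
From mathcomp Require Import all_boot all_order all_algebra.
From mathcomp Require Import all_classical all_reals all_analysis.

Set Implicit Arguments.
Unset Strict Implicit.
Unset Printing Implicit Defensive.

Import Order.TTheory GRing.Theory Num.Theory.
Import numFieldNormedType.Exports.

Local Open Scope classical_set_scope.
Local Open Scope ring_scope.

(* Normed modules that are finite dimensional: over the reals these are the
   normed (Minkowski) spaces. *)
#[short(type="normedVectType")]
HB.structure Definition NormedVector (R : numDomainType) :=
  {X of NormedModule R X & Vector R X}.

Section NormedSpace.
Variables (R : realType) (X : normedVectType R).

Definition unit_ball : set X := [set z | `|z| <= 1].

Definition unit_sphere : set X := [set z | `|z| = 1].

(* [H] is an affine hyperplane through [p] such that the set [K], which
   contains [p], lies in one of the two closed half-spaces bounded by [H].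
   Replacing [(f, c)] by [(- f, - c)] if necessary, this half-space is taken to
   be [[set z | f z <= c]]. *)
Definition supporting_hyperplane (K : set X) (p : X) (H : set X) : Prop :=
  exists (f : {scalar X}) (c : R),
    [/\ exists z, f z != 0,
        H = [set z | f z = c],
        K p /\ H p
      & K `<=` [set z | f z <= c]].

Definition smooth : Prop :=
  forall p : X, unit_sphere p ->
    exists! H : set X, supporting_hyperplane unit_ball p H.

(* The supremum is finite because [X] is finite dimensional. *)
Definition dual_norm (f : {scalar X}) : R := sup [set `|f z| | z in unit_ball].

Definition norming_at (x : X) (f : {scalar X}) : Prop :=
  (exists z, f z != 0) /\ f x = dual_norm f * `|x|.

(* An arbitrary nonzero functional attaining its norm at [x / `|x|], for
   [x != 0]; [0] is a default value that is never used for such [x], by the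
   Hahn-Banach theorem. In a smooth space the choice is unique up to a positive
   factor, so that [cm] does not depend on it. *)
Definition norming_functional (x : X) : {scalar X} :=
  xget (\0 : {scalar X}) (norming_at x).

Definition cm (x y : X) : R :=
  norming_functional x y / (dual_norm (norming_functional x) * `|y|).

Definition norm_quotient (x y : X) (t : R) : R := (`|x + t *: y| - `|x|) / t.

Definition g (x y : X) : R := `|x| * lim (norm_quotient x y t @[t --> 0^']).

End NormedSpace.

Arguments smooth {R} X.

(* Main.v *)
Require Import Defs.
From HB Require Import structures.
From mathcomp Require Import all_boot all_order all_algebra.
From mathcomp Require Import all_classical all_reals all_analysis.
From mathcomp Require Import ring lra.

(* Replacing a sublinear [p] by its one-sided derivative at [e] keeps it
   sublinear, does not increase it and makes it linear along [e]; doing this for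
   all vectors of a basis yields the Hahn-Banach theorem. Applied to the
   one-sided derivative of the norm at [x], it gives for each [y] a support
   functional at [x] whose value at [y] is the one-sided derivative in the
   direction [y]. By smoothness there is only one support functional [f], so
   the one-sided derivatives in the directions [y] and [- y] are [f y] and
   [- f y], and the two-sided derivative exists and equals [f y]. *)

Set Implicit Arguments.
Unset Strict Implicit.
Unset Printing Implicit Defensive.

Import Order.TTheory GRing.Theory Num.Theory.
Import numFieldNormedType.Exports.

Local Open Scope classical_set_scope.
Local Open Scope ring_scope.

Definition sublinear (R : realType) (X : lmodType R) (p : X -> R) : Prop :=
  (forall x y, p (x + y) <= p x + p y) /\
  (forall c x, 0 <= c -> p (c *: x) = c * p x).

Lemma sublinear0 (R : realType) (X : lmodType R) (p : X -> R) :
  sublinear p -> p 0 = 0.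
Proof. by move=> [_ hp]; rewrite -(scale0r 0) hp// mul0r. Qed.

Lemma sublinear_norm (R : realType) (X : normedModType R) :
  sublinear (fun z : X => `|z|).
Proof.
split=> [x y|c x c0]; first exact: ler_normD.
by rewrite normrZ ger0_norm.
Qed.

(** * One-sided derivatives of sublinear functions *)

Section DirectionalDerivative.
Variables (R : realType) (X : lmodType R) (p : X -> R).
Hypothesis hp : sublinear p.

(* The infimum is the right derivative of [p] at [e] in the direction [z]: with
   [t = 1 / s], the expression is [(p (e + s *: z) - p e) / s]. *)
Definition dir_deriv (e z : X) : R :=
  inf [set p (z + t *: e) - t * p e | t in [set t : R | 0 <= t]].

Lemma dir_deriv_has_inf e z :
  has_inf [set p (z + t *: e) - t * p e | t in [set t : R | 0 <= t]].
Proof.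
case: (hp) => hD hZ; split.
  by exists (p (z + 0 *: e) - 0 * p e); exists 0 => /=.
(* Lower bound: [t * p e = p (t *: e)], and [t *: e] is the sum of [z + t *: e] and [- z]. *)
exists (- p (- z)) => _ [t /= t0 <-].
have := hD (z + t *: e) (- z).
rewrite (addrC z) addrK hZ//; lra.
Qed.

Lemma dir_deriv_le e z t : 0 <= t -> dir_deriv e z <= p (z + t *: e) - t * p e.
Proof.
move=> t0; apply: ge_inf; last by exists t.
by case: (dir_deriv_has_inf e z).
Qed.

Lemma le_dir_deriv e z c :
  (forall t, 0 <= t -> c <= p (z + t *: e) - t * p e) -> c <= dir_deriv e z.
Proof.
move=> h; apply: lb_le_inf; first by case: (dir_deriv_has_inf e z).
by move=> _ [t /= t0 <-]; exact: h.
Qed.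

Lemma dir_deriv_lt e z c : dir_deriv e z < c ->
  exists2 t, 0 <= t & p (z + t *: e) - t * p e < c.
Proof.
move=> /inf_lt [|_ [t /= t0 <-] h]; first by case: (dir_deriv_has_inf e z).
by exists t.
Qed.

Lemma dir_deriv_le_self e z : dir_deriv e z <= p z.
Proof. by have := dir_deriv_le e z (lexx 0); rewrite scale0r addr0 mul0r subr0. Qed.

(** The choice [t = 1] cancels the argument of [p]. Together with [dir_deriv_le_self], this bound
    forces linearity along [e]. *)
Lemma dir_derivN e : dir_deriv e (- e) <= - p e.
Proof.
have := dir_deriv_le e (- e) ler01.
by rewrite scale1r addNr sublinear0// mul1r sub0r.
Qed.

(** Monotonicity of the difference quotients of a convex function, in the reciprocal parameter. *)
Lemma dir_quotient_nincr e z s t : s <= t ->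
  p (z + t *: e) - t * p e <= p (z + s *: e) - s * p e.
Proof.
case: hp => hD hZ st.
have st0 : 0 <= t - s by rewrite subr_ge0.
have := hD (z + s *: e) ((t - s) *: e).
by rewrite -addrA -scalerDl subrKC hZ//; lra.
Qed.

Lemma sublinear_dir_deriv e : sublinear (dir_deriv e).
Proof.
case: (hp) => hD hZ.
(* Substituting [c * t] in the infimum gives one inequality; the converse is the same one for [c^-1]
   at [c *: x]. Subadditivity adds the parameters of the two infima. *)
have le_Z c x : 0 < c -> dir_deriv e (c *: x) <= c * dir_deriv e x.
  move=> c0; rewrite -ler_pdivrMl//; apply: le_dir_deriv => t t0.
  rewrite ler_pdivrMl// (le_trans (dir_deriv_le _ _ (mulr_ge0 (ltW c0) t0)))//.
  by rewrite -scalerA -scalerDr hZ ?(ltW c0)// mulrBr mulrA.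
split=> [x y|c x].
  rewrite -lerBlDr; apply: le_dir_deriv => s s0.
  rewrite lerBlDr -lerBlDl; apply: le_dir_deriv => t t0.
  have := dir_deriv_le e (x + y) (addr_ge0 s0 t0).
  have := hD (x + s *: e) (y + t *: e).
  by rewrite scalerDl addrACA; lra.
rewrite le_eqVlt => /predU1P[c0|c0].
  rewrite -c0 scale0r mul0r; apply/eqP; rewrite eq_le; apply/andP; split.
    by rewrite -[leRHS](sublinear0 hp); exact: dir_deriv_le_self.
  by apply: le_dir_deriv => t t0; rewrite add0r hZ// subrr.
apply/eqP; rewrite eq_le le_Z//= -ler_pdivlMl//.
have ci : 0 < c^-1 by rewrite invr_gt0.
by have := le_Z _ (c *: x) ci; rewrite scalerA mulVf ?gt_eqF// scale1r.
Qed.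

End DirectionalDerivative.

(** * The Hahn-Banach theorem in finite dimension *)

(** Any sublinear [q] below the derivative at [e] is odd at [e], since
    [0 <= q e + q (- e) <= p e - p e]. Later derivatives only decrease the function, so this
    persists. *)
Lemma iter_dir_deriv (R : realType) (X : lmodType R) (s : seq X) (p : X -> R) :
  sublinear p -> exists q, [/\ sublinear q, forall z, q z <= p z &
    {in s, forall e, q (- e) = - q e}].
Proof.
elim: s p => [|e s IHs] p hp; first by exists p.
have [q [hq qp qs]] := IHs _ (sublinear_dir_deriv hp e).
exists q; split=> //.
  by move=> z; rewrite (le_trans (qp z))// dir_deriv_le_self.
move=> a; rewrite inE => /predU1P[->|]; last exact: qs.
have := hq.1 e (- e); rewrite subrr (sublinear0 hq).
have := qp (- e); have := qp e.
have := dir_deriv_le_self hp e e; have := dir_derivN hp e.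
lra.
Qed.

Lemma sublinear_basis_linear (R : realType) (X : vectType R) (q : X -> R) :
  sublinear q -> {in vbasis {:X}, forall e, q (- e) = - q e} ->
  scalar q.
Proof.
(* Additivity and homogeneity hold at vectors where [q] is odd, so oddness spreads from the basis to
   its linear combinations. *)
move=> hq qb; have [qD qZ] := hq.
have addE x y : q (- y) = - q y -> q (x + y) = q x + q y.
  move=> hy; apply/eqP; rewrite eq_le qD/=.
  by have := qD (x + y) (- y); rewrite addrK hy; lra.
have oppZ c x : q (- x) = - q x -> q (c *: x) = c * q x.
  move=> hx; have [c0|c0] := leP 0 c; first exact: qZ.
  have c0' : 0 <= - c by rewrite oppr_ge0 ltW.
  by have := qZ _ (- x) c0'; rewrite hx scaleNr scalerN opprK mulrNN.
have oppE x : q (- x) = - q x.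
  rewrite (coord_vbasis (memvf x)).
  elim/big_ind: _ => [|a b ha hb|i _].
  - by rewrite oppr0 (sublinear0 hq) oppr0.
  - by rewrite opprD !addE ?ha ?hb ?opprK// opprD.
  - have hi : q (- (vbasis {:X})`_i) = - q (vbasis {:X})`_i.
      by apply: qb; rewrite mem_nth// size_tuple.
    by rewrite -scaleNr !oppZ// mulNr.
by move=> c x y; rewrite addE// oppZ.
Qed.

Theorem hahn_banach (R : realType) (X : vectType R) (p : X -> R) (e : X) :
  sublinear p -> exists f : {scalar X}, (forall z, f z <= p z) /\ f e = p e.
Proof.
move=> hp.
(* Differentiating at [e] first pins the value there: [f e <= p e] and [- f e <= - p e]. *)
have [q [hq qp qb]] := iter_dir_deriv (vbasis {:X}) (sublinear_dir_deriv hp e).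
have lq := sublinear_basis_linear hq qb.
pose q_linear := GRing.isLinear.Build R X R *%R q lq.
pose f : {scalar X} := HB.pack q q_linear.
exists f; split=> [z|]; first by rewrite (le_trans (qp z))// dir_deriv_le_self.
have fN : f (- e) = - f e by rewrite linearN.
have := qp e; have := qp (- e); rewrite -[q _]/(f _) -[q e]/(f e) fN.
have := dir_deriv_le_self hp e e; have := dir_derivN hp e; lra.
Qed.

(** * Support functionals and the dual norm *)

Section SupportFunctional.
Variables (R : realType) (X : normedVectType R).
Implicit Types (f : {scalar X}) (x y z : X).

Definition support_functional x f : Prop :=
  (forall z, f z <= `|z|) /\ f x = `|x|.

Lemma le_norm_abs f C z : (forall z, f z <= C * `|z|) -> `|f z| <= C * `|z|.
Proof.
move=> h; rewrite ler_norml h andbT lerNl -linearN.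
by rewrite (le_trans (h _))// normrN.
Qed.

(* Norming functionals separate points, so by removing one vector at a time
   from a basis every functional is a combination of bounded ones. *)
Lemma functional_bounded f : exists C, forall z, f z <= C * `|z|.
Proof.
suff H (s : seq X) :
    (forall f : {scalar X}, {in s, forall v, f v = 0} ->
      exists C, forall z, f z <= C * `|z|) ->
    forall f : {scalar X}, exists C, forall z, f z <= C * `|z|.
  apply: (H (vbasis {:X})) => h hb; exists 0 => z.
  rewrite mul0r (coord_vbasis (memvf z)) linear_sum big1// => i _.
  by rewrite linearZ/= hb ?mulr0// mem_nth// size_tuple.
have [n] := ubnP (size s); elim: n s => // n IHn [|v s] /= sn hs {}f.
  exact: hs.
have [v0|v0] := eqVneq v 0.
  apply: (IHn s) => // h hh; apply: hs => w.
  rewrite inE => /predU1P[->|]; last exact: hh.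
  by rewrite v0 linear0.
have [g [gle gv]] := hahn_banach v (sublinear_norm X).
have gv0 : g v != 0 by rewrite gv normr_eq0.
(* The vectors are projected along [v] onto the kernel of [g]. If [h] vanishes on the projections,
   then [h - c g] vanishes on [v] and on [s]. *)
apply: (IHn [seq w - (g w / g v) *: v | w <- s]) => [|h hh].
  by rewrite size_map.
pose c := h v / g v.
have [C hC] : exists C, forall z, (h \- (c \*: g)) z <= C * `|z|.
  apply: hs => w; rewrite inE => /predU1P[->|ws] /=.
    by rewrite /c /= /GRing.scale /= divfK// subrr.
  have : h (w - (g w / g v) *: v) = 0 by apply: hh; apply/mapP; exists w.
  rewrite linearB linearZ /= /c /GRing.scale /= => /eqP; rewrite subr_eq0 => /eqP->.
  by field.
exists (C + `|c|) => z.
have := hC z; rewrite /= /GRing.scale /= mulrDl.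
have : c * g z <= `|c| * `|z|.
  rewrite (le_trans (ler_norm _))// normrM ler_wpM2l//.
  by have := @le_norm_abs g 1 z; rewrite mul1r; apply=> u; rewrite mul1r.
lra.
Qed.

Lemma dual_norm_le f C : (forall z, f z <= C * `|z|) -> 0 <= C -> dual_norm f <= C.
Proof.
move=> h C0; apply: sup_le_ub.
  by exists `|f 0|; exists 0 => //; rewrite /unit_ball/= normr0.
move=> _ [z /= z1 <-]; rewrite (le_trans (le_norm_abs z h))//.
by rewrite ler_piMr.
Qed.

Lemma le_dual_norm f z : `|f z| <= dual_norm f * `|z|.
Proof.
have [->|z0] := eqVneq z 0; first by rewrite linear0 !normr0 mulr0.
have nz : 0 < `|z| by rewrite normr_gt0.
rewrite -ler_pdivrMr//; apply: ub_le_sup.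
  (* Without a bound, the [sup] in [dual_norm] would be a default value. *)
  have [C hC] := functional_bounded f.
  exists `|C| => _ [w /= w1 <-]; rewrite (le_trans (le_norm_abs w hC))//.
  by rewrite (le_trans (ler_wpM2r _ (ler_norm C)))// ler_piMr.
exists (`|z|^-1 *: z); last first.
  by rewrite linearZ/= normrM normfV normr_id mulrC.
by rewrite /unit_ball/= normrZ normfV normr_id mulVf// gt_eqF.
Qed.

Lemma support_functional_dual_norm x f : x != 0 ->
  support_functional x f -> dual_norm f = 1.
Proof.
move=> x0 [fle fx]; apply/eqP; rewrite eq_le dual_norm_le//=; last first.
  by move=> z; rewrite mul1r.
have := le_dual_norm f x; rewrite fx normr_id -ler_pdivrMr ?normr_gt0//.
by rewrite divff// normr_eq0.
Qed.

Lemma support_functional_norming x f : x != 0 ->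
  support_functional x f -> norming_at x f.
Proof.
move=> x0 sf; split; last first.
  by rewrite (support_functional_dual_norm x0 sf) mul1r; exact: sf.2.
by exists x; rewrite sf.2 normr_eq0.
Qed.

(** The level set at 1 of a support functional is a supporting hyperplane at the normalized [x];
    smoothness identifies these level sets, and each determines its functional. *)
Lemma smooth_support_uniq x (f h : {scalar X}) : smooth X -> x != 0 ->
  support_functional x f -> support_functional x h -> f =1 h.
Proof.
move=> hX x0 sf sh.
have nx : `|x| != 0 by rewrite normr_eq0.
pose u := `|x|^-1 *: x.
have u1 : `|u| = 1 by rewrite normrZ normfV normr_id mulVf.
have at_u (k : {scalar X}) : support_functional x k -> k u = 1.
  by move=> [_ kx]; rewrite linearZ/= kx mulVf.
have supp (k : {scalar X}) : support_functional x k ->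
    supporting_hyperplane (@unit_ball R X) u [set z | k z = 1].
  move=> sk; exists k, 1; split=> //.
  - by exists u; rewrite at_u// oner_neq0.
  - by split; [rewrite /unit_ball/= u1|exact: at_u].
  - by move=> z /= z1; rewrite (le_trans (sk.1 z)).
have [H [_ Huniq]] := hX u u1.
have fh : [set z | f z = 1] = [set z | h z = 1].
  by rewrite -(Huniq _ (supp f sf)) -(Huniq _ (supp h sh)).
have transfer z : f z = 1 -> h z = 1.
  by move=> fz; have : [set z | f z = 1] z by []; rewrite fh.
(* Level 1 is reached by adding [u] when [f z = 0], and by rescaling otherwise. *)
move=> z; have [fz|fz] := eqVneq (f z) 0.
  have : f (z + u) = 1 by rewrite linearD/= fz add0r at_u.
  by move=> /transfer; rewrite linearD/= at_u// fz; lra.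
have : f ((f z)^-1 *: z) = 1 by rewrite linearZ/= mulVf.
move=> /transfer; rewrite linearZ/=.
by move=> /(congr1 ( *%R (f z))); rewrite mulr1 mulVKf.
Qed.

Lemma support_functional_exists x y : exists f,
  support_functional x f /\ f y = dir_deriv (fun z : X => `|z|) x y.
Proof.
have hn := sublinear_norm X.
have [f [fle fy]] := hahn_banach y (sublinear_dir_deriv hn x).
exists f; split=> //.
have fn z : f z <= `|z| by rewrite (le_trans (fle z))// dir_deriv_le_self.
split=> //; apply/eqP; rewrite eq_le fn/= -lerN2 -linearN.
by rewrite (le_trans (fle _))// dir_derivN.
Qed.

(** * Differentiability of the norm and the cosine function *)

Lemma norm_quotient_cvg x y f : smooth X -> x != 0 -> support_functional x f ->
  norm_quotient x y t @[t --> 0^'] --> f y.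
Proof.
move=> hX x0 sf; have hn := sublinear_norm X.
have derivE z : dir_deriv (fun z : X => `|z|) x z = f z.
  have [k [sk <-]] := support_functional_exists x z.
  exact: smooth_support_uniq sk sf z.
(* A parameter [s] nearly attaining the infimum serves for all [t] with [s <= t^-1], by
   monotonicity. The summand 1 covers [s = 0]. *)
have approx z e : 0 < e -> exists2 s, 0 <= s & forall t, 0 < t -> t < (1 + s)^-1 ->
    f z <= norm_quotient x z t < f z + e.
  move=> e0; have : dir_deriv (fun z : X => `|z|) x z < f z + e.
    by rewrite derivE ltrDl.
  move=> /(dir_deriv_lt hn)[s s0 hs]; exists s => // t t0 ts.
  have s10 : 0 < 1 + s by lra.
  have tV : s <= t^-1.
    have : (1 + s) < t^-1 by rewrite -[1 + s]invrK ltf_pV2// ?posrE// invr_gt0.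
    lra.
  have -> : norm_quotient x z t = `|z + t^-1 *: x| - t^-1 * `|x|.
    rewrite /norm_quotient mulrBl [_^-1 * `|x|]mulrC; congr (_ - _).
    have -> : z + t^-1 *: x = t^-1 *: (x + t *: z).
      by rewrite scalerDr scalerA mulVf ?gt_eqF// scale1r addrC.
    by rewrite normrZ gtr0_norm ?invr_gt0// mulrC.
  have tV0 : 0 <= t^-1 by rewrite invr_ge0 ltW.
  rewrite -{1}derivE (dir_deriv_le hn)//=.
  exact: le_lt_trans (dir_quotient_nincr hn x z tV) hs.
apply/cvgrPdist_lt => e e0.
have [s s0 hs] := approx y e e0.
have [r r0 hr] := approx (- y) e e0.
have d0 : 0 < (1 + (s + r))^-1 by rewrite invr_gt0; lra.
have dle (a b : R) : 0 <= a -> a <= b -> (1 + b)^-1 <= (1 + a)^-1.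
  by move=> a0 ab; rewrite lef_pV2 ?posrE; lra.
have ds := dle s (s + r) s0 ltac:(lra).
have dr := dle r (s + r) r0 ltac:(lra).
rewrite /dnbhs; near=> t.
have tn0 : t != 0 by near: t; exact: nbhs_dnbhs_neq.
have td : `|t| < (1 + (s + r))^-1 by near: t; apply: dnbhs0_lt.
have [t0|t0|t0] := ltgtP t 0; last by rewrite t0 eqxx in tn0.
- have tN : 0 < - t by lra.
  have : - t < (1 + r)^-1 by rewrite (lt_le_trans _ dr)// -(ltr0_norm t0).
  move=> /(hr _ tN); rewrite linearN.
  (* A left quotient towards [y] is minus a right quotient towards [- y]. *)
  have -> : norm_quotient x (- y) (- t) = - norm_quotient x y t.
    by rewrite /norm_quotient scalerN scaleNr opprK invrN mulrN.
  by rewrite ltr_norml; lra.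
- have : t < (1 + s)^-1 by rewrite (lt_le_trans _ ds)// -(gtr0_norm t0).
  by move=> /(hs _ t0); rewrite ltr_norml; lra.
Unshelve. all: by end_near. Qed.

(** Divided by its dual norm, the chosen norming functional is a support functional at [x], hence
    equals [f] by uniqueness. *)
Lemma norming_functionalE x f : smooth X -> x != 0 -> support_functional x f ->
  0 < dual_norm (norming_functional x) /\
  forall y, norming_functional x y = dual_norm (norming_functional x) * f y.
Proof.
move=> hX x0 sf.
have : norming_at x (norming_functional x).
  exact: xgetPex (ex_intro _ f (support_functional_norming x0 sf)).
set k := norming_functional x; set M := dual_norm k => -[[z kz] kx].
have M0 : 0 < M.
  have := le_dual_norm k z; rewrite -/M => kM.
  have : 0 < M * `|z| by rewrite (lt_le_trans _ kM)// normr_gt0.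
  by rewrite pmulr_lgt0// normr_gt0; apply: contraNneq kz => ->; rewrite linear0.
split=> // y.
have sk : support_functional x (M^-1 \*: k).
  split=> [w|]; rewrite /= /GRing.scale /=.
    by rewrite ler_pdivrMl// (le_trans (ler_norm _))// le_dual_norm.
  by rewrite kx mulKf// gt_eqF.
have := smooth_support_uniq hX x0 sf sk y.
by rewrite /= /GRing.scale /= => ->; rewrite mulVKf// gt_eqF.
Qed.

End SupportFunctional.

(** The convergence claim ensures that the [lim] in [g] is a genuine limit, not a default value. *)
Theorem proposition2p4p1 (R : realType) (X : normedVectType R) (hX : smooth X) :
  (forall x y : X, x != 0 -> cvg (norm_quotient x y t @[t --> 0^'])) /\
  (forall x y : X, x != 0 -> y != 0 -> cm x y = g x y / (`|x| * `|y|)).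
Proof.
split=> [x y x0|x y x0 y0]; have [f [sf _]] := support_functional_exists x y.
  by apply/cvg_ex; exists (f y); exact: norm_quotient_cvg.
have [M0 kE] := norming_functionalE hX x0 sf.
rewrite /cm /g kE (cvg_lim _ (norm_quotient_cvg (y := y) hX x0 sf))//.
have := normr_eq0 x; have := normr_eq0 y; rewrite (negbTE x0) (negbTE y0).
by move=> /negbT ny /negbT nx; field; rewrite ny nx gt_eqF.
Qed.
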